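(* Let $\mathcal{U}$ be a fixed universal prediction system and let $K(\cdot)$ be prefix complexity of prediction systems. There is a constant $c>0$ such that, for any prediction system $\mathcal{L}$ and any $N\in\mathbb{N}$, $$\mathcal{L}_{\le N}\subseteq\mathcal{U}_{\le c\,2^{K(\mathcal{L})}N}.$$
   Context: $\mathbf{X}$ is a fixed finite set of binary strings, $\mathbb{2}:=\{0,1\}$, $\mathbb{N}=\{1,2,\ldots\}$. Elements of $(\mathbf{X}\times\mathbb{2})^*$ are called finite data sequences. A set of finite sequences (of data or of bits) is prefix-free if it contains no two distinct elements one of which is a prefix of the other. A law of nature is a recursively enumerable prefix-free subset of $(\mathbf{X}\times\mathbb{2})^*$ (possibly empty). A prediction system is a sequence $\mathcal{L}=(L_1,L_2,\ldots)$ of laws of nature such that $\{(\sigma,n)\in(\mathbf{X}\times\mathbb{2})^*\times\mathbb{N}\mid\sigma\in L_n\}$ is recursively enumerable. For real $r\ge0$, $\mathcal{L}_{\le r}:=\bigcup_{n\in\mathbb{N},\,n\le r}L_n$. A prediction system $\mathcal{U}$ is universal if for any prediction system $\mathcal{L}$ there is a constant $c>0$ such that $\mathcal{L}_{\le N}\subseteq\mathcal{U}_{\le cN}$ for all $N\in\mathbb{N}$ (universal prediction systems exist). A description language for prediction systems is a (total) function $F$ mapping $\mathbb{2}^*$ to the set of all prediction systems such that, writing $F(d)=(F_1(d),F_2(d),\ldots)$, the set $\{(d,\sigma,n)\mid\sigma\in F_n(d)\}\subseteq\mathbb{2}^*\times(\mathbf{X}\times\mathbb{2})^*\times\mathbb{N}$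 is recursively enumerable; it is prefix-free if $\mathrm{dom}(F):=\{d\mid F(d)\ne(\emptyset,\emptyset,\ldots)\}$ is prefix-free. Set $C_F(\mathcal{L}):=\min\{|d|\mid\mathcal{L}=F(d)\}$ ($\min\emptyset:=\infty$). A prefix-free description language $U'$ for prediction systems is universal if for any prefix-free description language $F$ for prediction systems there is a constant $c$ with $C_{U'}(\mathcal{L})\le C_F(\mathcal{L})+c$ for all prediction systems $\mathcal{L}$; such $U'$ exist, one is fixed, and the prefix complexity of $\mathcal{L}$ is $K(\mathcal{L}):=C_{U'}(\mathcal{L})$. *)

(* Defs.v *)
From HB Require Import structures.
From mathcomp Require Import all_boot all_order all_algebra finmap.
From mathcomp Require Import boolp classical_sets reals constructive_ereal ereal exp.

Set Implicit Arguments.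
Unset Strict Implicit.
Unset Printing Implicit Defensive.

Import Order.TTheory GRing.Theory Num.Theory.

Local Open Scope classical_set_scope.
Local Open Scope ring_scope.

(* Total recursive functions of k natural-number arguments: the least class
   containing zero, successor and the projections that is closed under
   composition, primitive recursion, and minimization of regular functions.
   In [rec_min], the premise says that [g v] is the least zero of [f (_, v)], so
   minimization is only applied when it yields a total function. *)
Inductive recursive : forall k : nat, (k.-tuple nat -> nat) -> Prop :=
| rec_zero k : recursive (fun _ : k.-tuple nat => 0%N)
| rec_succ : recursive (fun v : 1.-tuple nat => (thead v).+1)
| rec_proj k (i : 'I_k) : recursive (fun v : k.-tuple nat => tnth v i)
| rec_comp k m (f : m.-tuple nat -> nat) (g : 'I_m -> k.-tuple nat -> nat) :
    recursive f -> (forall i, recursive (g i)) ->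
    recursive (fun v : k.-tuple nat => f [tuple g i v | i < m])
| rec_prim k (f : k.-tuple nat -> nat) (g : k.+2.-tuple nat -> nat)
    (h : k.+1.-tuple nat -> nat) :
    recursive f -> recursive g ->
    (forall v : k.-tuple nat, h [tuple of 0%N :: v] = f v) ->
    (forall n (v : k.-tuple nat), h [tuple of n.+1 :: v]
                 = g [tuple of n :: h [tuple of n :: v] :: v]) ->
    recursive h
| rec_min k (f : k.+1.-tuple nat -> nat) (g : k.-tuple nat -> nat) :
    recursive f ->
    (forall v : k.-tuple nat, f [tuple of g v :: v] = 0%N /\
               forall i, (i < g v)%N -> f [tuple of i :: v] <> 0%N) ->
    recursive g.

(* [A] is listed by the values of a total recursive function, where the value 0
   lists nothing (so that the empty set is covered) and [n.+1] lists the
   element with code [n].  [choice.pickle] is a concrete computable coding of all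
   the types at which this is used: it is built from [CodeSeq.code] on lists and
   pairs, and is the index in an enumeration on the finite type [X] below. *)
Definition recursively_enumerable (T : countType) (A : set T) : Prop :=
  exists f : 1.-tuple nat -> nat, recursive f /\
    forall x, A x <-> exists t : nat, f [tuple t] = (choice.pickle x).+1.

Definition prefix_free (T : eqType) (A : set (seq T)) : Prop :=
  forall s t, A s -> A t -> prefix s t -> s = t.

Definition posnat := {n : nat | (0 < n)%N}.

Section PredictionSystems.
Context (R : realType) (X : {fset bitseq}).

Definition data : countType := seq (X * bool).

Definition law_of_nature (A : set data) : Prop :=
  recursively_enumerable A /\ prefix_free A.

Definition system := posnat -> set data.

Definition prediction_system (L : system) : Prop :=
  (forall n, law_of_nature (L n)) /\
  recursively_enumerable [set p : data * posnat | L p.2 p.1].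

(* The bound is extended-real only so that it may be computed from a
   complexity, which is formally allowed to be infinite; the bound +oo gives
   the union of all laws. *)
Definition upto (L : system) (r : \bar R) : set data :=
  \bigcup_(n in [set n : posnat | ((val n)%:R%:E <= r)%E]) L n.

Definition universal_system (U : system) : Prop :=
  prediction_system U /\
  forall L, prediction_system L -> exists c : R, 0 < c /\
    forall N : posnat,
      upto L (val N)%:R%:E `<=` upto U (c * (val N)%:R)%:E.

Definition description_language (F : bitseq -> system) : Prop :=
  (forall d, prediction_system (F d)) /\
  recursively_enumerable
    [set p : bitseq * data * posnat | F p.1.1 p.2 p.1.2].

Definition dom (F : bitseq -> system) : set bitseq :=
  [set d | F d <> fun=> set0].

Definition prefix_description_language (F : bitseq -> system) : Prop :=
  description_language F /\ prefix_free (dom F).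

(* An infimum of natural numbers, hence a minimum when [L] has a description;
   +oo otherwise. *)
Definition complexity (F : bitseq -> system) (L : system) : \bar R :=
  ereal_inf [set (size d)%:R%:E | d in [set d | L = F d]].

Definition universal_description_language (U' : bitseq -> system) : Prop :=
  prefix_description_language U' /\
  forall F, prefix_description_language F -> exists c : R,
    forall L, prediction_system L ->
      (complexity U' L <= complexity F L + c%:E)%E.

End PredictionSystems.

Definition pow2 (R : realType) (x : \bar R) : \bar R :=
  match x with
  | r%:E => (2 `^ r)%:E
  | +oo => +oo
  | -oo => 0
  end%E.

(* Main.v *)
(** The laws of all systems [U' d] are merged into one prediction system whose
    [m]-th law is [U' d]_k, where [m = 2^|d| k + v(d)] and [v(d)] is the number
    with binary digits [d], least significant first.  If [m] arises from two
    pairs [(d, k)] and [(d', k')], both [d] and [d'] are initial parts of the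
    binary expansion of [m], so one is a prefix of the other; as [dom U'] is
    prefix-free, each merged law is a single law of some [U' d], or empty.
    Since [m < 2^|d| (k + 1)], universality of [U] applied to the merged system
    gives the bound when [K(L)] is finite; when it is infinite, universality of
    [U] applied to [L] suffices. *)
Require Import Defs.
From HB Require Import structures.
From mathcomp Require Import all_boot all_order all_algebra finmap.
From mathcomp Require Import boolp classical_sets reals constructive_ereal ereal exp.

Set Implicit Arguments.
Unset Strict Implicit.
Unset Printing Implicit Defensive.

Import Order.TTheory GRing.Theory Num.Theory.

Local Open Scope classical_set_scope.

Local Open Scope nat_scope.

(** * Closure properties and recursive arithmetic *)

Definition recursive1 (f : nat -> nat) :=
  recursive (fun v : 1.-tuple nat => f (tnth v ord0)).
Definition recursive2 (f : nat -> nat -> nat) :=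
  recursive (fun v : 2.-tuple nat => f (tnth v ord0) (tnth v ord_max)).
Definition recursive3 (f : nat -> nat -> nat -> nat) :=
  recursive (fun v : 3.-tuple nat => f (tnth v ord0) (tnth v (lift ord0 ord0)) (tnth v ord_max)).

Lemma recursive_comp1 k f (u : k.-tuple nat -> nat) :
  recursive1 f -> recursive u -> recursive (fun v => f (u v)).
Proof.
move=> f_rec u_rec.
have := rec_comp f_rec (fun _ : 'I_1 => u_rec).
by congr recursive; apply: funext => v; rewrite tnth_mktuple.
Qed.

Lemma recursive_comp2 k f (u1 u2 : k.-tuple nat -> nat) :
  recursive2 f -> recursive u1 -> recursive u2 ->
  recursive (fun v => f (u1 v) (u2 v)).
Proof.
move=> f_rec u1_rec u2_rec.
have := @rec_comp k 2 _ (fun i => nth u1 [:: u1; u2] i) f_rec.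
have u_rec i : recursive (nth u1 [:: u1; u2] (i : 'I_2)) by case: i => -[|[]].
move=> /(_ u_rec).
by congr recursive; apply: funext => v; rewrite !tnth_mktuple.
Qed.

Lemma recursive_comp3 k f (u1 u2 u3 : k.-tuple nat -> nat) :
  recursive3 f -> recursive u1 -> recursive u2 -> recursive u3 ->
  recursive (fun v => f (u1 v) (u2 v) (u3 v)).
Proof.
move=> f_rec u1_rec u2_rec u3_rec.
have := @rec_comp k 3 _ (fun i => nth u1 [:: u1; u2; u3] i) f_rec.
have u_rec i : recursive (nth u1 [:: u1; u2; u3] (i : 'I_3)).
  by case: i => -[|[|[]]].
move=> /(_ u_rec).
by congr recursive; apply: funext => v; rewrite !tnth_mktuple.
Qed.

Lemma recursive1_succ : recursive1 succn.
Proof.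
by have := rec_succ; congr recursive; apply: funext => v; rewrite (tnth_nth 0).
Qed.

Lemma recursive_const k n : recursive (fun _ : k.-tuple nat => n).
Proof.
elim: n => [|n IHn]; first exact: rec_zero.
exact: (recursive_comp1 recursive1_succ IHn).
Qed.

Lemma recursive2_primrec a g (h : nat -> nat -> nat) :
  recursive1 a -> recursive3 g ->
  (forall x, h 0 x = a x) -> (forall n x, h n.+1 x = g n (h n x) x) ->
  recursive2 h.
Proof.
move=> a_rec g_rec h0 hS; apply: (rec_prim a_rec g_rec) => [v|n v].
  by rewrite !(tnth_nth 0) /= h0.
by rewrite !(tnth_nth 0) /= hS.
Qed.

Lemma recursive1_primrec a g (h : nat -> nat) :
  recursive2 g -> h 0 = a -> (forall n, h n.+1 = g n (h n)) -> recursive1 h.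
Proof.
move=> g_rec h0 hS.
(* A dummy argument turns recursion without parameters into recursion with one. *)
suff h_rec : recursive2 (fun n _ => h n).
  exact: (recursive_comp2 h_rec (rec_proj _) (recursive_const _ 0)).
apply: (recursive2_primrec (a := fun=> a) (g := fun n y _ => g n y)) => //.
  exact: recursive_const.
exact: recursive_comp2 g_rec (rec_proj _) (rec_proj _).
Qed.

Lemma recursive2_iter f : recursive1 f -> recursive2 (fun n => iter n f).
Proof.
move=> f_rec.
apply: (recursive2_primrec (a := id) (g := fun _ y _ => f y)) => //.
  exact: rec_proj.
exact: recursive_comp1 f_rec (rec_proj _).
Qed.

Lemma recursive2_addn : recursive2 addn.
Proof.
apply: (recursive2_primrec (a := id) (g := fun _ y _ => y.+1)) => //.
  exact: rec_proj.
exact: recursive_comp1 recursive1_succ (rec_proj _).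
Qed.

Lemma recursive2_muln : recursive2 muln.
Proof.
apply: (recursive2_primrec (a := fun=> 0) (g := fun _ y x => x + y)) => //.
  exact: recursive_const.
exact: recursive_comp2 recursive2_addn (rec_proj _) (rec_proj _).
Qed.

Lemma recursive2_sum F :
  recursive2 F -> recursive2 (fun n x => \sum_(i < n) F i x).
Proof.
move=> F_rec.
apply: (recursive2_primrec (a := fun=> 0) (g := fun n y x => y + F n x)).
- exact: recursive_const.
- apply: (recursive_comp2 recursive2_addn (rec_proj _)).
  exact: recursive_comp2 F_rec (rec_proj _) (rec_proj _).
- by move=> x; rewrite big_ord0.
- by move=> n x; rewrite big_ord_recr.
Qed.

Lemma recursive1_eq0 : recursive1 (fun x => x == 0).
Proof.
apply: (recursive1_primrec (a := 1) (g := fun _ _ => 0)) => //.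
exact: recursive_const.
Qed.

Lemma recursive1_neq0 : recursive1 (fun x => x != 0).
Proof.
apply: (recursive1_primrec (a := 0) (g := fun _ _ => 1)) => //.
exact: recursive_const.
Qed.

Lemma recursive3_cond : recursive3 (fun c x y => if c == 0 then x else y).
Proof.
suff: recursive3 (fun c x y => (c == 0) * x + (c != 0) * y).
  congr recursive3; apply: funext => c; apply: funext => x; apply: funext => y.
  by case: eqP; rewrite ?mul1n ?addn0.
apply: (recursive_comp2 recursive2_addn).
  apply: (recursive_comp2 recursive2_muln) (rec_proj _).
  exact: recursive_comp1 recursive1_eq0 (rec_proj _).
apply: (recursive_comp2 recursive2_muln) (rec_proj _).
exact: recursive_comp1 recursive1_neq0 (rec_proj _).
Qed.

Lemma recursive1_odd : recursive1 (fun x => odd x).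
Proof.
apply: (recursive1_primrec (a := 0) (g := fun _ y => y == 0)) => //.
  exact: recursive_comp1 recursive1_eq0 (rec_proj _).
by move=> n /=; case: odd.
Qed.

Lemma recursive1_half : recursive1 half.
Proof.
apply: (recursive1_primrec (a := 0) (g := fun n y => odd n + y)) => //.
  apply: (recursive_comp2 recursive2_addn) (rec_proj _).
  exact: recursive_comp1 recursive1_odd (rec_proj _).
by move=> n; rewrite -uphalf_half.
Qed.

Lemma recursive1_expn2 : recursive1 (expn 2).
Proof.
apply: (recursive1_primrec (a := 1) (g := fun _ y => 2 * y)) => //.
  exact: recursive_comp2 recursive2_muln (recursive_const _ _) (rec_proj _).
by move=> n; rewrite expnS.
Qed.

Lemma iter_half_expn2 n x : iter n half (2 ^ n * x) = x.
Proof.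
elim: n => [|n IHn]; first by rewrite mul1n.
by rewrite iterSr expnS -mulnA mul2n doubleK.
Qed.

Lemma iter_half_expn2_lt i n x :
  i < n -> iter i half (2 ^ n * x) = (2 ^ (n - i.+1) * x).*2.
Proof.
move=> lt_in; rewrite -mul2n mulnA -expnS subnSK //.
by rewrite -{1}(subnKC (ltnW lt_in)) expnD -mulnA iter_half_expn2.
Qed.

(** Obtained by minimization: for positive [x], the exponent of 2 is the least [n] such that [n]
    halvings of [x] give an odd number. *)
Lemma recursive1_logn2 : recursive1 (logn 2).
Proof.
(* No halving of 0 is ever odd, so [x = 0] is declared a zero at once; this keeps the search total
   and agrees with [logn 2 0 = 0]. *)
pose f (n x : nat) : nat := if x == 0 then 0 else odd (iter n half x) == 0 :> nat.
have f_min x : f (logn 2 x) x = 0 /\ forall i, i < logn 2 x -> f i x <> 0.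
  have [-> //|x_gt0] := posnP x.
  have [m m_odd def_x] := pfactor_coprime (isT : prime 2) x_gt0.
  rewrite coprime2n mulnC in m_odd def_x.
  have fE i : f i x = (odd (iter i half x) == 0 :> nat) by rewrite /f gtn_eqF.
  move: (logn 2 x) def_x => n def_x; split=> [|i lt_in]; rewrite fE def_x.
    by rewrite iter_half_expn2 m_odd.
  by rewrite iter_half_expn2_lt ?odd_double.
suff f_rec : recursive2 f.
  apply: (rec_min f_rec) => v; have [fg0 lt_g] := f_min (tnth v ord0).
  by rewrite !(tnth_nth 0) /= in fg0 lt_g *; split=> // i /lt_g;
    rewrite !(tnth_nth 0).
apply: (recursive_comp3 recursive3_cond (rec_proj _) (recursive_const _ _)).
apply: (recursive_comp1 recursive1_eq0); apply: (recursive_comp1 recursive1_odd).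
exact: recursive_comp2 (recursive2_iter recursive1_half) (rec_proj _) (rec_proj _).
Qed.

(** * Coding of pairs *)

(** Closed form of the library code of a pair, so that [choice.pickle] can be handled by recursive
    arithmetic. *)
Definition pair_code a b := 2 ^ a * (2 ^ b.+1).+1.
Definition pair_fst x := logn 2 x.
(** Stripping the powers of 2 from a pair code leaves [2 ^ b.+1 + 1]; one more halving gives
    [2 ^ b]. *)
Definition pair_snd x := logn 2 (iter (logn 2 x) half x)./2.

Lemma code_pair a b : CodeSeq.code [:: a; b] = pair_code a b.
Proof. by rewrite /pair_code /= muln1 expnS mul2n. Qed.

Lemma pair_codeK1 a b : pair_fst (pair_code a b) = a.
Proof.
rewrite /pair_fst /pair_code lognM ?expn_gt0 // pfactorK //.
by rewrite lognE /= dvdn2 /= oddX /= addn0.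
Qed.

Lemma pair_codeK2 a b : pair_snd (pair_code a b) = b.
Proof.
rewrite /pair_snd [logn 2 (pair_code a b)]pair_codeK1 iter_half_expn2.
by rewrite expnS mul2n /= uphalf_double pfactorK.
Qed.

Lemma recursive2_pair_code : recursive2 pair_code.
Proof.
have expn2_rec k (u : k.-tuple nat -> nat) := recursive_comp1 (u := u) recursive1_expn2.
have succ_rec k (u : k.-tuple nat -> nat) := recursive_comp1 (u := u) recursive1_succ.
apply: (recursive_comp2 recursive2_muln (expn2_rec _ _ (rec_proj _))).
exact: succ_rec (expn2_rec _ _ (succ_rec _ _ (rec_proj _))).
Qed.

Lemma recursive1_pair_snd : recursive1 pair_snd.
Proof.
apply: (recursive_comp1 recursive1_logn2); apply: (recursive_comp1 recursive1_half).
apply: (recursive_comp2 (recursive2_iter recursive1_half)) (rec_proj _).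
exact: recursive_comp1 recursive1_logn2 (rec_proj _).
Qed.

(** * Numbering of the merged laws *)

(** This is [2 ^ size d * k + v(d)], written so that parity and halving peel off the head of [d]. *)
Fixpoint slot (d : bitseq) (k : nat) : nat :=
  if d is b :: d' then b + (slot d' k).*2 else k.

Lemma ltn_slot d k : slot d k < 2 ^ size d * k.+1.
Proof.
elim: d => [|b d IHd] /=; first by rewrite mul1n.
rewrite expnS -mulnA mul2n -(leq_double) doubleS in IHd *.
by apply: leq_trans IHd; case: b.
Qed.

Lemma slot_gt0 d k : 0 < k -> 0 < slot d k.
Proof. by move=> k_gt0; elim: d => //= b d; rewrite -double_gt0 addn_gt0 orbC => ->. Qed.

Lemma slot_inj d : injective (slot d).
Proof. by elim: d => //= b d IHd k k' /addnI /double_inj /IHd. Qed.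

(** Parity determines the first digit and halving passes to the remaining ones, so the two strings
    agree until one of them ends. *)
Lemma slot_prefix d d' k k' :
  slot d k = slot d' k' -> prefix d d' \/ prefix d' d.
Proof.
elim: d d' => [|b d IHd] [|b' d'] /= eq_i; rewrite ?prefix0s; try by [left|right].
have eq_b : b = b' by move/(congr1 odd): eq_i; rewrite !oddD !odd_double !oddb !addbF.
by move: eq_i; rewrite eq_b eqxx => /addnI /double_inj /IHd.
Qed.

(** * Computing [slot] from codes of bit strings *)

(** A string with head [b] and tail of code [c] has code [2 ^ b * (2 * c + 1)]: parity reveals [b],
    and one or two halvings give [c]. The code 0 of the empty string is a fixed point. *)
Definition code_tail x := if odd x == 0 :> nat then x./2./2 else x./2.
(** The value 0 at [x = 0] lets sums run past the end of the string without changing. *)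
Definition code_head x := if x == 0 then 0 else odd x == 0 :> nat.

(* On codes of bit strings this is [slot], with [x] serving as a bound on the
   length of the string coded by [x]. *)
Definition code_slot x k :=
  \sum_(i < x) code_head (iter i code_tail x) * 2 ^ i +
  2 ^ (\sum_(i < x) (iter i code_tail x != 0)) * k.

Lemma recursive1_code_tail : recursive1 code_tail.
Proof.
have half_rec k (u : k.-tuple nat -> nat) := recursive_comp1 (u := u) recursive1_half.
apply: (recursive_comp3 recursive3_cond).
- exact: recursive_comp1 recursive1_odd (rec_proj _).
- exact: half_rec (half_rec _ _ (rec_proj _)).
- exact: half_rec _ _ (rec_proj _).
Qed.

Lemma recursive2_iter_code_tail : recursive2 (fun i x => iter i code_tail x).
Proof. exact: recursive2_iter recursive1_code_tail. Qed.

Lemma recursive1_code_head : recursive1 code_head.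
Proof.
apply: (recursive_comp3 recursive3_cond (rec_proj _) (recursive_const _ _)).
apply: (recursive_comp1 recursive1_eq0).
exact: recursive_comp1 recursive1_odd (rec_proj _).
Qed.

Lemma recursive2_code_slot : recursive2 code_slot.
Proof.
have expn2_rec k (u : k.-tuple nat -> nat) := recursive_comp1 (u := u) recursive1_expn2.
have sum_rec F : recursive2 F ->
    recursive (fun v : 2.-tuple nat => \sum_(i < tnth v ord0) F i (tnth v ord0)).
  by move=> /recursive2_sum F_rec; apply: recursive_comp2 F_rec (rec_proj _) (rec_proj _).
apply: (recursive_comp2 recursive2_addn).
  apply: (sum_rec (fun i x => code_head (iter i code_tail x) * 2 ^ i)).
  apply: (recursive_comp2 recursive2_muln); last exact: expn2_rec (rec_proj _).
  exact: recursive_comp1 recursive1_code_head recursive2_iter_code_tail.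
apply: (recursive_comp2 recursive2_muln) (rec_proj _); apply: expn2_rec.
apply: (sum_rec (fun i x => iter i code_tail x != 0)).
exact: recursive_comp1 recursive1_neq0 recursive2_iter_code_tail.
Qed.

Definition bits_code (d : bitseq) := CodeSeq.code (map nat_of_bool d).
Arguments bits_code : simpl never.

Lemma code_cons b d : bits_code (b :: d) = 2 ^ b * (bits_code d).*2.+1.
Proof. by []. Qed.

Lemma code_tailE b d : code_tail (bits_code (b :: d)) = bits_code d.
Proof.
rewrite code_cons /code_tail; case: b; rewrite ?mul1n ?mul2n /= odd_double /=.
  by rewrite doubleK uphalf_double.
by rewrite uphalf_double.
Qed.

Lemma code_headE b d : code_head (bits_code (b :: d)) = b.
Proof. by rewrite code_cons /code_head; case: b; rewrite ?mul1n ?mul2n /= odd_double. Qed.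

Lemma leq_size_code d : size d <= bits_code d.
Proof.
elim: d => // b d IHd; rewrite code_cons (leq_trans _ (leq_pmull _ _)) ?expn_gt0 //.
by rewrite ltnS (leq_trans IHd) // -addnn leq_addr.
Qed.

Lemma iter_code_tail0 i : iter i code_tail 0 = 0.
Proof. by elim: i => //= i ->. Qed.

Lemma code_slotE d k : code_slot (bits_code d) k = slot d k.
Proof.
rewrite /code_slot.
(* The bound is decoupled from the code, which changes in the induction on [d]; terms beyond the
   length of [d] vanish. *)
suff slotE n : size d <= n ->
    \sum_(i < n) code_head (iter i code_tail (bits_code d)) * 2 ^ i
    + 2 ^ (\sum_(i < n) (iter i code_tail (bits_code d) != 0)) * k = slot d k.
  exact/slotE/leq_size_code.
elim: d n => [|b d IHd] n /= => [_|].
  by rewrite !big1 ?mul1n // => i _; rewrite iter_code_tail0.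
case: n => // n /IHd {}IHd; rewrite !big_ord_recl.
have iter_tail i : iter i.+1 code_tail (bits_code (b :: d)) = iter i code_tail (bits_code d).
  by rewrite iterSr code_tailE.
under eq_bigr do rewrite lift0 iter_tail expnS mulnCA.
under [X in 2 ^ (_ + X)]eq_bigr do rewrite lift0 iter_tail.
rewrite -big_distrr /= code_headE muln1 code_cons muln_eq0 expn_eq0 /=.
by rewrite expnS -mulnA -addnA -mulnDr IHd mul2n.
Qed.

(** * Recognizing codes of bit strings *)

(** Flags the nonzero multiples of 4: these code lists whose first entry is at least 2, hence not a
    bit. *)
Definition code_bad x := if x == 0 then 0 else odd x + odd x./2 == 0 :> nat.

(** Every positive number is [2 ^ n * (2 * c + 1)]; the test forces [n] to be a bit, and the
    argument descends to [c], which is smaller. *)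
Lemma code_onto x :
  \sum_(i < x) code_bad (iter i code_tail x) = 0 -> exists d, x = bits_code d.
Proof.
move/eqP; rewrite sum_nat_eq0 => /forallP/= bad0.
have {bad0}: forall i, i < x -> code_bad (iter i code_tail x) = 0.
  by move=> i lt_ix; apply/eqP/(bad0 (Ordinal lt_ix)).
(* The bound on [x] and the number of tested iterates become one induction variable [n]. *)
have: x <= x by []; move: {2 3}x => n.
elim: n x => [|n IHn] x; first by rewrite leqn0 => /eqP-> _; exists [::].
have [-> _ _|x_gt0 le_xn bad0] := posnP x; first by exists [::].
have [|i lt_in|d def_d] := IHn (code_tail x).
- rewrite -ltnS (leq_trans _ le_xn) // /code_tail.
  have lt_half y : 0 < y -> y./2 < y by move=> ?; rewrite ltn_half_double -addnn -[X in X < _]addn0 ltn_add2l.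
  case: ifP => _; last exact: lt_half.
  by rewrite (leq_ltn_trans _ (lt_half _ x_gt0)) // leq_half_double -addnn -addnS leq_addr.
- by rewrite -iterSr bad0.
exists ((odd x == 0 :> nat) :: d).
rewrite code_cons -{}def_d; have /= := bad0 0 isT.
rewrite /code_bad /code_tail gtn_eqF //.
have def_x := odd_double_half x; have def_x2 := odd_double_half x./2.
case odd_x: (odd x) => //= in def_x *; first by rewrite mul1n.
by case odd_x2: (odd x./2) => //= in def_x2 *; rewrite mul2n -{1}def_x -{1}def_x2.
Qed.

Lemma recursive1_code_bad : recursive1 code_bad.
Proof.
apply: (recursive_comp3 recursive3_cond (rec_proj _) (recursive_const _ _)).
apply: (recursive_comp1 recursive1_eq0); apply: (recursive_comp2 recursive2_addn).
  exact: recursive_comp1 recursive1_odd (rec_proj _).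
apply: (recursive_comp1 recursive1_odd).
exact: recursive_comp1 recursive1_half (rec_proj _).
Qed.

(** * Recursive relabelling of listed triples *)

Lemma recursive1_pred : recursive1 predn.
Proof. exact: (recursive1_primrec (a := 0) (g := fun n _ => n)) (rec_proj _) _ _. Qed.

Lemma recursive2_neq : recursive2 (fun x y => x != y).
Proof.
(* Recursion runs on the first argument, so the subtracted number comes first. *)
have sub_rec : recursive2 (fun x y => y - x).
  apply: (recursive2_primrec (a := id) (g := fun _ y _ => y.-1)) => //.
  - exact: rec_proj.
  - exact: recursive_comp1 recursive1_pred (rec_proj _).
  - by move=> x; rewrite subn0.
  - by move=> n x; rewrite subnS.
suff: recursive2 (fun x y => (y - x) + (x - y) != 0).
  congr recursive2; apply: funext => x; apply: funext => y.
  by rewrite addn_eq0 !subn_eq0 -eqn_leq eq_sym.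
apply: (recursive_comp1 recursive1_neq0); apply: (recursive_comp2 recursive2_addn).
  exact: recursive_comp2 sub_rec (rec_proj _) (rec_proj _).
exact: recursive_comp2 sub_rec (rec_proj _) (rec_proj _).
Qed.

(** On codes, a triple [(d, s, k)] becomes the pair [(s, slot d k)], which turns a listing of [F]
    into one of [merge F]. *)
Definition relabel y :=
  pair_code (pair_snd (pair_fst y)) (code_slot (pair_fst (pair_fst y)) (pair_snd y)).

(* An enumerating function may also output numbers that are not codes of any
   triple [(d, s, k)]; these have to be discarded before relabelling. *)
Definition relabel_bad y :=
  (pair_code (pair_fst y) (pair_snd y) != y)
  + (pair_code (pair_fst (pair_fst y)) (pair_snd (pair_fst y)) != pair_fst y)
  + \sum_(i < pair_fst (pair_fst y))
      code_bad (iter i code_tail (pair_fst (pair_fst y)))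
  + (pair_snd y == 0).

Lemma relabelE d s k :
  relabel (pair_code (pair_code (bits_code d) s) k) = pair_code s (slot d k).
Proof. by rewrite /relabel !(pair_codeK1, pair_codeK2) code_slotE. Qed.

Lemma relabel_bad0 y : relabel_bad y = 0 <->
  exists d s k, 0 < k /\ y = pair_code (pair_code (bits_code d) s) k.
Proof.
split=> [/eqP|[d [s [k [k_gt0 ->]]]]].
  rewrite /relabel_bad !addn_eq0 -!andbA => /and4P[].
  rewrite !eqb0 !negbK => /eqP y_pair /eqP y1_pair /eqP/code_onto[d y11_code] k_neq0.
  exists d, (pair_snd (pair_fst y)), (pair_snd y); split; first by rewrite lt0n.
  by rewrite -y11_code y1_pair y_pair.
rewrite /relabel_bad !(pair_codeK1, pair_codeK2) !eqxx gtn_eqF // addn0 big1 //=.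
(* Shedding digits reduces the [i]-th test to the head of a bit string code, or to the code 0. *)
move=> [i i_lt] _; rewrite [nat_of_ord _]/=; elim: i d {i_lt} => [|i IHi] [|b d] //=.
- rewrite code_cons /code_bad; case: b; rewrite ?mul1n ?mul2n /= ?odd_double //.
  by rewrite doubleK odd_double.
- by rewrite -iterS iter_code_tail0.
- by rewrite -iterS iterSr code_tailE.
Qed.

Lemma recursive1_relabel : recursive1 relabel.
Proof.
have fst_rec k (u : k.-tuple nat -> nat) := recursive_comp1 (u := u) recursive1_logn2.
have snd_rec k (u : k.-tuple nat -> nat) := recursive_comp1 (u := u) recursive1_pair_snd.
apply: (recursive_comp2 recursive2_pair_code).
  exact: snd_rec (fst_rec _ _ (rec_proj _)).
apply: (recursive_comp2 recursive2_code_slot).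
  exact: fst_rec (fst_rec _ _ (rec_proj _)).
exact: snd_rec (rec_proj _).
Qed.

Lemma recursive1_relabel_bad : recursive1 relabel_bad.
Proof.
have fst_rec k (u : k.-tuple nat -> nat) := recursive_comp1 (u := u) recursive1_logn2.
have snd_rec k (u : k.-tuple nat -> nat) := recursive_comp1 (u := u) recursive1_pair_snd.
have fst1_rec := fst_rec 1 _ (rec_proj ord0).
have pair_rec k (u1 u2 : k.-tuple nat -> nat) :=
  recursive_comp2 (u1 := u1) (u2 := u2) recursive2_pair_code.
apply: (recursive_comp2 recursive2_addn); last first.
  exact: recursive_comp1 recursive1_eq0 (snd_rec _ _ (rec_proj _)).
apply: (recursive_comp2 recursive2_addn); last first.
  have sum_rec : recursive2 (fun n x => \sum_(i < n) code_bad (iter i code_tail x)).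
    apply: (recursive2_sum (F := fun i x => code_bad (iter i code_tail x))).
    exact: recursive_comp1 recursive1_code_bad recursive2_iter_code_tail.
  exact: recursive_comp2 sum_rec (fst_rec _ _ fst1_rec) (fst_rec _ _ fst1_rec).
apply: (recursive_comp2 recursive2_addn).
  apply: (recursive_comp2 recursive2_neq) (rec_proj _).
  exact: pair_rec fst1_rec (snd_rec _ _ (rec_proj _)).
apply: (recursive_comp2 recursive2_neq _ fst1_rec).
exact: pair_rec (fst_rec _ _ fst1_rec) (snd_rec _ _ fst1_rec).
Qed.

(** * The merged prediction system *)

Definition merge (X : {fset bitseq}) (F : bitseq -> system X) : system X :=
  fun m => [set s | exists d k, val m = slot d (val k) /\ F d k s]%classic.

Lemma merge_recursively_enumerable (X : {fset bitseq}) (F : bitseq -> system X) :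
  description_language F ->
  recursively_enumerable [set p : data X * posnat | merge F p.2 p.1]%classic.
Proof.
case=> _ [f [f_rec f_enum]].
(* The value 0 lists nothing and [n.+1] lists [n], hence the predecessor and successor; ill-formed
   values are sent to 0. *)
pose g z := if z == 0 then 0 else
  if relabel_bad z.-1 == 0 then (relabel z.-1).+1 else 0.
exists (fun v => g (f v)); split.
  suff g_rec : recursive1 g by exact: recursive_comp1 g_rec f_rec.
  have pred_rec := recursive_comp1 recursive1_pred (rec_proj (@ord0 0)).
  apply: (recursive_comp3 recursive3_cond (rec_proj _) (recursive_const _ _)).
  apply: (recursive_comp3 recursive3_cond _ _ (recursive_const _ _)).
    exact: recursive_comp1 recursive1_relabel_bad pred_rec.
  apply: (recursive_comp1 recursive1_succ).
  exact: recursive_comp1 recursive1_relabel pred_rec.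
(* The library codings unfold by computation: a positive number is coded by its value, a bit by 0 or
   1. *)
have pickle3 (d : bitseq) (s : data X) (k : posnat) : choice.pickle (d, s, k)
    = pair_code (pair_code (bits_code d) (choice.pickle s)) (val k).
  by rewrite -!code_pair.
have pickle2 (s : data X) (m : posnat) : choice.pickle (s, m)
    = pair_code (choice.pickle s) (val m).
  by rewrite -code_pair.
have pair_inj a b a' b' : pair_code a b = pair_code a' b' -> a = a' /\ b = b'.
  by move=> eq_ab; split; [rewrite -(pair_codeK1 a b) | rewrite -(pair_codeK2 a b)];
    rewrite eq_ab ?pair_codeK1 ?pair_codeK2.
case=> s m /=; split=> [[d [k [m_slot Fdks]]]|[t]].
  have [t ft] := (f_enum (d, s, k)).1 Fdks.
  exists t; rewrite ft pickle2 pickle3 /g /=.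
  have -> /= : relabel_bad (pair_code (pair_code (bits_code d) (choice.pickle s)) (val k)) = 0.
    by apply/relabel_bad0; exists d, (choice.pickle s), (val k); split; first exact: valP k.
  by rewrite relabelE m_slot.
rewrite /g; case ft: (f _) => [|y] //=.
case: eqP => // /relabel_bad0[d [p [k [k_gt0 def_y]]]] [].
(* Comparison with the code of [(s, m)] identifies the middle component [p] as the code of [s]. *)
rewrite def_y relabelE pickle2 => /pair_inj[def_p m_slot].
exists d, (exist _ k k_gt0); split=> //=.
by apply/(f_enum (d, s, _)); exists t; rewrite ft def_y def_p pickle3.
Qed.

Lemma merge_law (X : {fset bitseq}) (F : bitseq -> system X) :
  prefix_description_language F -> forall m, law_of_nature (merge F m).
Proof.
case=> -[F_sys _] F_prefix m.
(* Either some element [s] witnesses a law [F d k] numbered [m], which puts [d] in [dom F], or the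
   merged law is empty. *)
have [[d [k [m_slot [s Fdks]]]]|merge0] :=
    EM (exists d k, val m = slot d (val k) /\ exists s, F d k s).
  suff -> : merge F m = F d k by exact: (F_sys d).1.
  apply/seteqP; split=> [s' [d' [k' [m_slot' Fdks']]]|s' ?]; last by exists d, k.
  have in_dom d1 k1 s1 : F d1 k1 s1 -> dom F d1.
    by rewrite /dom /= => + F0; rewrite F0.
  have eq_d : d = d'.
    have [dp|dp] := slot_prefix (etrans (esym m_slot) m_slot').
      exact: F_prefix (in_dom _ _ _ Fdks) (in_dom _ _ _ Fdks') dp.
    exact/esym/(F_prefix _ _ (in_dom _ _ _ Fdks') (in_dom _ _ _ Fdks) dp).
  rewrite -eq_d in m_slot' Fdks'.
  (* Once the descriptions agree, the number [m] also determines the index. *)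
  by rewrite (_ : k = k') //; apply/val_inj/(@slot_inj d); rewrite -m_slot.
have empty s : ~ merge F m s.
  by case=> d [k [m_slot Fdks]]; apply: merge0; exists d, k; split=> //; exists s.
split; last by move=> s ? /empty.
exists (fun=> 0); split; first exact: rec_zero.
by move=> s; split=> [/empty|[]].
Qed.

Lemma merge_system (X : {fset bitseq}) (F : bitseq -> system X) :
  prefix_description_language F -> prediction_system (merge F).
Proof.
move=> F_prefix; split; first exact: merge_law.
exact: merge_recursively_enumerable F_prefix.1.
Qed.

(** * Complexity and the final bound *)

Local Open Scope classical_set_scope.
Local Open Scope ring_scope.

(** For [1 <= n <= N] one has [n + 1 <= 2 * N], so [slot d n < 2 ^ size d * (n + 1) <= 2 ^ (size
    d).+1 * N]; this is where the extra factor 2 arises. *)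
Lemma upto_sub_merge (R : realType) (X : {fset bitseq}) (F : bitseq -> system X)
    (d : bitseq) (N M : posnat) :
  (2 ^ (size d).+1 * val N <= val M)%N ->
  upto (F d) ((val N)%:R : R)%:E `<=` upto (merge F) ((val M)%:R : R)%:E.
Proof.
move=> le_NM s [n]; rewrite /= lee_fin ler_nat => le_nN Fdns.
have m_gt0 := slot_gt0 d (valP n).
exists (exist (fun m => 0 < m)%N _ m_gt0); last by exists d, n.
rewrite /= lee_fin ler_nat (leq_trans (ltnW (ltn_slot _ _))) //.
apply: leq_trans le_NM; rewrite expnSr -mulnA leq_mul2l; apply/orP; right.
rewrite mul2n -addnn; apply: leq_trans (leq_add le_nN le_nN).
by rewrite -addn1 leq_add2l; exact: valP n.
Qed.

(** Lengths are natural numbers, so a nonempty set of them has a least element; the infimum of the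
    empty set is [+oo]. *)
Lemma complexity_attained (R : realType) (X : {fset bitseq})
    (F : bitseq -> system X) (L : system X) :
  complexity R F L = +oo%E \/
  exists d, L = F d /\ complexity R F L = (size d)%:R%:E.
Proof.
have [[d def_L]|noL] := EM (exists d, L = F d); last first.
  left; rewrite /complexity (_ : [set d | L = F d] = set0) ?image_set0 ?ereal_inf0 //.
  by apply/seteqP; split=> // d Ld; apply: noL; exists d.
right; pose P n := `[< exists d, L = F d /\ size d = n >].
have exP : exists n, P n by exists (size d); apply/asboolP; exists d.
case: (ex_minnP exP) => _ /asboolP[d' [def_L' <-]] min_d'.
exists d'; split=> //; apply/le_anti/andP; split.
  by apply: ereal_inf_lbound; exists d'.
apply/ereal_infP => _ [d'' def_L'' <-]; rewrite lee_fin ler_nat.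
by apply: min_d'; apply/asboolP; exists d''.
Qed.

Theorem theorem3 (R : realType) (X : {fset bitseq}) (U : system X)
    (U' : bitseq -> system X) (hU : universal_system R U)
    (hU' : universal_description_language R U') :
  exists c : R, 0 < c /\
    forall L : system X, prediction_system L -> forall N : posnat,
      upto L ((val N)%:R : R)%:E `<=`
      upto U (c%:E * pow2 (complexity R U' L) * (val N)%:R%:E)%E.
Proof.
have [c [c_gt0 U_merge]] := hU.2 _ (merge_system hU'.1).
(* Here [c] compares [merge U'] with [U], and 2 is the loss in passing from [U' d] to [merge U']. *)
exists (c * 2); split=> [|L L_sys N]; first by rewrite mulr_gt0.
have [->|[d [-> ->]]] := complexity_attained R U' L.
  (* At infinite complexity the required bound is [+oo], so a constant [c'] depending on [L] is
     enough. *)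
  have [c' [_ U_L]] := hU.2 _ L_sys.
  move=> s /U_L[n _ Uns]; exists n => //=.
  by rewrite gt0_muley ?lte_fin ?mulr_gt0 // gt0_mulye ?lte_fin ?ltr0n ?(valP N) ?leey.
(* With [d] a shortest description, universality is applied at [M = 2 ^ (size d).+1 * N]. *)
have M_gt0 : (0 < 2 ^ (size d).+1 * val N)%N by rewrite muln_gt0 expn_gt0 (valP N).
move=> s /(@upto_sub_merge R X U' d N (exist (fun m => 0 < m)%N _ M_gt0) (leqnn _)) /U_merge.
by rewrite /= powR_mulrn // -!EFinM natrM natrX exprS !mulrA.
Qed.
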